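(* Every double-critical $k$-chromatic non-complete graph with $k\ge 6$ is $6$-connected.
   Context: All graphs are finite and simple. A graph $G$ is (vertex-)critical if $\chi(G-v)<\chi(G)$ for every vertex $v\in V(G)$. A critical graph $G$ is double-critical if $\chi(G-x-y)\le\chi(G)-2$ for every edge $xy\in E(G)$. *)

(* Defs.v *)
From mathcomp Require Import all_boot.
Set Implicit Arguments. Unset Strict Implicit. Unset Printing Implicit Defensive.

(* A finite simple graph G: vertex type T : finType, adjacency e : rel T,
   which is assumed symmetric and irreflexive (hypotheses of the theorem).
   Subgraphs G - S are the induced subgraphs on vertex sets A : {set T}. *)

Section Graphs.
Variable T : finType.
Variable e : rel T.

(* G[A] has a proper colouring with colours in {0,..,k-1}.
   (Colour values are taken in 'I_k.+1 only to get a finite search space;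
   vertices of A must receive colours < k.) *)
Definition colorable (A : {set T}) (k : nat) : bool :=
  [exists f : {ffun T -> 'I_k.+1},
     [forall x in A, f x < k] &&
     [forall x in A, forall y in A, e x y ==> (f x != f y)]].

(* chromatic number of G[A]: least k such that G[A] is k-colourable.
   For a loopless graph, k = #|T| always works, so the search over
   0..#|T| finds the true minimum. *)
Definition chi (A : {set T}) : nat := find (colorable A) (iota 0 #|T|.+1).

Definition chiG : nat := chi [set: T].

Definition critical : Prop := forall v : T, chi [set~ v] < chiG.

Definition double_critical : Prop :=
  critical /\ forall x y : T, e x y -> chi (~: [set x; y]) <= chiG - 2.

Definition complete : Prop := forall x y : T, x != y -> e x y.

(* G[A] is connected (the empty graph counts as connected here; irrelevant
   below since k-connectivity requires more than k vertices) *)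
Definition connected_on (A : {set T}) : Prop :=
  forall x y, x \in A -> y \in A ->
    connect [rel a b | [&& e a b, a \in A & b \in A]] x y.

Definition k_connected (k : nat) : Prop :=
  k < #|T| /\ forall S : {set T}, #|S| < k -> connected_on (~: S).

End Graphs.

(* Main.v *)
(* Let S be a separating set with at most 5 vertices, and H1, H2 two nonempty
   unions of components of G - S covering it. All degrees are at least k >= 6
   (a vertex of degree k - 1 would, with its neighbourhood, form a K_k), so H1
   and H2 each span an edge; deleting the ends of an edge of H2 shows that
   G[S + H1] has a (k-2)-colouring f, and likewise G[S + H2] a
   (k-2)-colouring g. One more colour is allowed: it may be given to an
   independent subset A of S in f and B of S in g. Since |S| <= 5, a finite
   check on pairs of partitions of S shows that A and B can be chosen, each
   inside a colour class of f or of g, so that the two recoloured partitions of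
   S coincide. After permuting colours the colourings agree on S, and G is
   (k-1)-colourable, a contradiction. *)

Require Import Defs.
From mathcomp Require Import all_boot all_fingroup.
Set Implicit Arguments. Unset Strict Implicit. Unset Printing Implicit Defensive.

(** * The finite check on pairs of partitions of at most five points *)

Definition extract {A B : Type} (P : A -> bool) (f : A -> B) (a : A) : option B :=
  if P a then None else Some (f a).

(* Every partition of {0,..,n-1} is the kernel of the sequence sending each
   index to the least member of its class; such sequences satisfy p_i <= i. *)
Fixpoint growth_seqs (n : nat) : seq (seq nat) :=
  if n is m.+1 then [seq rcons p c | p <- growth_seqs m, c <- iota 0 n]
  else [:: [::]].

Fixpoint masks (n : nat) : seq bitseq :=
  if n is m.+1 then [seq b :: s | b <- [:: false; true], s <- masks m]
  else [:: [::]].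

Definition canonical (p : seq nat) : bool := [seq index c p | c <- p] == p.

Definition constant_on (p : seq nat) (m : bitseq) : bool := constant (mask m p).

Definition same_kernel (p q : seq nat) (m1 m2 : bitseq) : bool :=
  let r := iota 0 (size p) in
  let u := extract (nth false m1) (nth 0 p) in
  let v := extract (nth false m2) (nth 0 q) in
  all (fun i => all (fun j => (u i == u j) == (v i == v j)) r) r.

(** Both masks range over subsets of classes of [p] or of [q]: in the application [p] and [q] come
    from proper colourings, so such subsets are independent. *)
Definition extractable (n : nat) : bool :=
  let ps := [seq p <- growth_seqs n | canonical p] in
  all (fun p => all (fun q =>
    let ms := [seq m <- masks n | constant_on p m || constant_on q m] in
    has (fun m1 => has (same_kernel p q m1) ms) ms) ps) ps.

(** Pure computation; the largest case has 52 partitions of five points, hence 2704 pairs. *)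
Lemma extractable_le5 : all extractable (iota 0 6).
Proof. by lazy. Qed.

Lemma mem_growth_seqs (p : seq nat) :
  (forall i, i < size p -> nth 0 p i <= i) -> p \in growth_seqs (size p).
Proof.
elim/last_ind: p => [|p c IHp] // le_p; rewrite size_rcons.
apply: allpairs_f.
  apply: IHp => i ltip; have := le_p i; rewrite size_rcons nth_rcons ltip.
  by apply; apply: ltnW.
have := le_p (size p); rewrite size_rcons nth_rcons ltnn eqxx mem_iota add0n.
by move=> /(_ (leqnn _)).
Qed.

(** * From colourings to canonical sequences and back *)

Section ColourPattern.
Variables (T C : eqType) (s : seq T) (f : T -> C).

Definition first_index (x : T) : nat := index (f x) (map f s).

Lemma eq_first_index x y : x \in s ->
  (first_index x == first_index y) = (f x == f y).
Proof.
move=> sx; apply/eqP/eqP => [|eq_f]; last by rewrite /first_index eq_f.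
have fx : f x \in map f s by apply: map_f.
rewrite /first_index => eq_i.
have fy : f y \in map f s by rewrite -index_mem -eq_i index_mem.
by rewrite -(nth_index (f x) fx) eq_i nth_index.
Qed.

Lemma pattern_canonical : canonical (map first_index s).
Proof.
apply/eqP; rewrite -map_comp; apply/eq_in_map => x sx /=.
rewrite [RHS]/first_index /index !find_map; apply: eq_in_find => y sy /=.
exact: eq_first_index.
Qed.

Lemma pattern_growth : map first_index s \in growth_seqs (size s).
Proof.
rewrite -(size_map first_index); apply: mem_growth_seqs => i.
rewrite size_map => ltis; have x0 : T by case: s ltis.
rewrite (nth_map x0) // /first_index -(nth_map x0 (f x0)) //.
rewrite leqNgt; apply/negP => /(before_find (f x0)) /=.
by rewrite eqxx.
Qed.

End ColourPattern.

Lemma constant_onP (T : eqType) (s : seq T) (f : T -> nat) m :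
  constant_on (map f s) m -> {in mask m s &, forall x y, f x = f y}.
Proof.
rewrite /constant_on -map_mask => /(constantP 0)[c eq_c] x y mx my.
have eqc z : z \in mask m s -> f z = c.
  by move=> /(map_f f); rewrite eq_c mem_nseq => /andP[_ /eqP].
by rewrite !eqc.
Qed.

Definition monochromatic (T C : eqType) (A : {pred T}) (f : T -> C) : Prop :=
  {in A &, forall x y, f x = f y}.

(** The finite check sees a colouring only through equality of colours, which [first_index]
    preserves; the masks found there become [A] and [B]. *)
Lemma common_extraction (T : finType) (C D : eqType) (S : {set T})
    (f : T -> C) (g : T -> D) : #|S| <= 5 ->
  exists A B : {set T},
    [/\ A \subset S, B \subset S,
        monochromatic A f \/ monochromatic A g,
        monochromatic B f \/ monochromatic B g &
        {in S &, forall x y,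
          (extract (mem A) f x == extract (mem A) f y) =
          (extract (mem B) g x == extract (mem B) g y)}].
Proof.
move=> S5; pose s := enum S.
have ss : size s = #|S| by rewrite cardE.
have us : uniq s by apply: enum_uniq.
have /(allP extractable_le5) : size s \in iota 0 6 by rewrite mem_iota ss.
move=> /allP/(_ (map (first_index s f) s)).
rewrite mem_filter pattern_canonical pattern_growth => /(_ isT).
move=> /allP/(_ (map (first_index s g) s)).
rewrite mem_filter pattern_canonical pattern_growth => /(_ isT).
case/hasP=> m1; rewrite mem_filter => /andP[mono1 _].
case/hasP=> m2; rewrite mem_filter => /andP[mono2 _] same.
have mono m : constant_on (map (first_index s f) s) m
           || constant_on (map (first_index s g) s) m ->
    monochromatic [set x in mask m s] f \/ monochromatic [set x in mask m s] g.
  case/orP=> /constant_onP mon; [left|right] => x y; rewrite !inE => mx my;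
    apply/eqP; rewrite -(eq_first_index (s := s)) ?(mem_mask mx) //;
    apply/eqP; exact: mon.
have sub m : [set x in mask m s] \subset S.
  by apply/subsetP => x; rewrite inE => /mem_mask; rewrite mem_enum.
exists [set x in mask m1 s], [set x in mask m2 s]; split; try exact: sub; try exact: mono.
move=> x y; rewrite -!(mem_enum S) -/s => sx sy.
move: same; rewrite /same_kernel size_map.
have ix z : z \in s -> index z s \in iota 0 (size s).
  by move=> sz; rewrite mem_iota index_mem.
move=> /allP/(_ _ (ix _ sx))/allP/(_ _ (ix _ sy))/eqP.
rewrite /extract /= !inE !in_mask // sx sy /=.
rewrite !(nth_map x) ?index_mem // !nth_index //.
have eq1 (E : eqType) (a b : E) : (Some a == Some b) = (a == b) by [].
by do 4![case: ifP => _ //]; rewrite !eq1 !eq_first_index.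
Qed.

(** Induction on [s]: a repeated colour needs no change, and a fresh one is corrected by a
    transposition that fixes all earlier values. *)
Lemma perm_matching (T : eqType) (C : finType) (s : seq T) (f g : T -> C) :
  {in s &, forall x y, (f x == f y) = (g x == g y)} ->
  exists p : {perm C}, {in s, forall x, p (f x) = g x}.
Proof.
elim: s => [|a s IHs] eq_fg; first by exists 1%g.
have [|p eq_p] := IHs.
  by move=> x y sx sy; apply: eq_fg; rewrite inE ?sx ?sy orbT.
have [/hasP[b sb /eqP fab]|/hasPn nfa] := boolP (has (fun x => f x == f a) s).
  exists p => x; rewrite inE => /predU1P[->|]; last exact: eq_p.
  rewrite -fab eq_p //; apply/eqP; rewrite -eq_fg ?fab //; rewrite inE ?eqxx //.
  by rewrite sb orbT.
exists (p * tperm (p (f a)) (g a))%g => x; rewrite permM inE => /predU1P[->|sx].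
  by rewrite tpermL.
have pfx := eq_p x sx; rewrite tpermD // eq_sym.
  by rewrite (inj_eq perm_inj) nfa.
by rewrite pfx -eq_fg ?inE ?eqxx ?sx ?orbT // nfa.
Qed.

(** * Proper colourings, gluing and minimum degree *)

Section Colourings.
Variables (T : finType) (e : rel T).
Hypotheses (esym : symmetric e) (eirr : irreflexive e).

Definition proper (C : eqType) (A : {set T}) (f : T -> C) : Prop :=
  {in A &, forall x y, e x y -> f x != f y}.

Lemma proper_sub (C : eqType) (A B : {set T}) (f : T -> C) :
  A \subset B -> proper B f -> proper A f.
Proof. by move=> /subsetP sAB pf x y /sAB Bx /sAB By; apply: pf. Qed.

(** The vertices of [B] share [None], which no other vertex receives. *)
Lemma proper_extract (C : eqType) (A B : {set T}) (f : T -> C) :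
  proper A f -> {in B &, forall x y, ~~ e x y} ->
  proper A (extract (mem B) f).
Proof.
move=> pf ind x y Ax Ay exy; rewrite /extract /=.
case: ifP => Bx; case: ifP => By //; last exact: pf.
by move: (ind x y Bx By); rewrite exy.
Qed.

Lemma proper_colorable (C : finType) (A : {set T}) (f : T -> C) k :
  #|C| <= k -> proper A f -> colorable e A k.
Proof.
move=> leCk pf; apply/existsP; exists [ffun x => inord (enum_rank (f x))].
have lt x : enum_rank (f x) < k by apply: leq_trans leCk.
apply/andP; split; first by apply/forall_inP=> x _; rewrite ffunE inordK // ltnS ltnW.
apply/forall_inP => x Ax; apply/forall_inP => y Ay; apply/implyP => exy.
rewrite !ffunE -val_eqE /= !inordK ?ltnS 1?ltnW //.
by rewrite (inj_eq (@ord_inj _)) (inj_eq enum_rank_inj) pf.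
Qed.

(** The successor keeps the colour type inhabited: vertices outside [A] need a value too. *)
Lemma colorable_proper (A : {set T}) k :
  colorable e A k.+1 -> exists f : T -> 'I_k.+1, proper A f.
Proof.
case/existsP=> f /andP[/forall_inP ltf /forall_inP pf].
exists (fun x => inord (f x)) => x y Ax Ay exy.
have /forall_inP/(_ y Ay)/implyP/(_ exy) := pf x Ax.
by rewrite -!val_eqE /= !inordK ?ltf.
Qed.

Lemma colorable_chi (A : {set T}) : colorable e A (chi e A).
Proof.
have has_col : has (colorable e A) (iota 0 #|T|.+1).
  apply/hasP; exists #|T|; first by rewrite mem_iota add0n leqnn.
  apply: (@proper_colorable _ _ id) => // x y _ _.
  by apply: contraTneq => ->; rewrite eirr.
have := nth_find 0 has_col; rewrite nth_iota ?add0n //.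
by rewrite has_find size_iota in has_col.
Qed.

Lemma colorable_leq (A : {set T}) k m : k <= m -> colorable e A k -> colorable e A m.
Proof.
case: k => [|k] lekm.
  (* With zero colours [A] is empty, so a constant colouring works vacuously. *)
  case/existsP=> f /andP[/forall_inP ltf _].
  apply/existsP; exists [ffun=> ord0]; apply/andP; split;
    by apply/forall_inP => x /ltf; rewrite ltn0.
by case/colorable_proper=> f; apply: proper_colorable; rewrite card_ord.
Qed.

Lemma chi_leq (A : {set T}) k : colorable e A k -> chi e A <= k.
Proof.
move=> colk; rewrite leqNgt; apply/negP => ltk.
have le_chi : chi e A <= #|T|.+1 by rewrite -[#|T|.+1](size_iota 0) find_size.
have := before_find 0 ltk; rewrite nth_iota ?add0n ?colk //.
exact: leq_trans ltk le_chi.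
Qed.

(** This yields at least [#|C|] triangles on each edge: the common neighbours of its ends meet every
    colour. *)
Lemma common_neighbour (C : finType) (x y : T) (f : T -> C) (c : C) :
  ~~ colorable e setT #|C|.+1 -> e x y -> proper (~: [set x; y]) f ->
  exists z, [/\ e x z, e y z & f z = c].
Proof.
move=> ncol exy pf.
case: (pickP (fun z => [&& e x z, e y z & f z == c])) => [z|none].
  by case/and3P=> exz eyz /eqP; exists z.
have nz z : e x z -> e y z -> (f z == c) = false.
  by move=> exz eyz; have := none z; rewrite exz eyz.
(* Colour y with a new colour, x with c, and move the neighbours of x coloured
   c to the new colour. *)
case/negP: ncol.
pose g z := if z == y then None else if z == x then Some c
  else if e x z && (f z == c) then None else Some (f z).
apply: (@proper_colorable _ _ g); first by rewrite card_option.
have gy : g y = None by rewrite /g eqxx.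
have gx : g x = Some c.
  by rewrite /g eqxx; case: eqP exy => // ->; rewrite eirr.
(* Any edge other than [xy] has an end outside [{x, y}]; by symmetry let it be [v]. *)
suff half u v : e u v -> g u = g v -> v != y -> v != x -> False.
  move=> u v _ _ euv; apply/eqP => guv.
  have [vy|vy] := eqVneq v y; last first.
    have [vx|vx] := eqVneq v x; last exact: (half u v).
    have [uy|uy] := eqVneq u y.
      by move: guv; rewrite uy vx gx gy.
    have [ux|ux] := eqVneq u x; first by move: euv; rewrite ux vx eirr.
    by apply: (half v u) => //; rewrite esym.
  have [uy|uy] := eqVneq u y; first by move: euv; rewrite uy vy eirr.
  have [ux|ux] := eqVneq u x.
    by move: guv; rewrite ux vy gx gy.
  by apply: (half v u) => //; rewrite esym.
move=> euv; rewrite /g => + vy vx; rewrite (negPf vy) (negPf vx).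
case: eqP euv => [->|/eqP uy] euv.
  by case: ifP => // /andP[exv]; rewrite nz.
case: eqP euv => [->|/eqP ux] euv; first by rewrite euv /=; case: eqP => // ne [cf]; case: ne.
have fuv : f u != f v by apply: pf => //; rewrite !inE negb_or ?ux ?vx.
case: ifP => [/andP[_ /eqP fu]|_]; case: ifP => [/andP[_ /eqP fv]|_] //.
  by move: fuv; rewrite fu fv eqxx.
by case=> fE; move: fuv; rewrite fE eqxx.
Qed.

Lemma colorable_glue (C : finType) (S H1 H2 : {set T}) (f g : T -> C) :
  #|S| <= 5 -> S :|: H1 :|: H2 = setT ->
  {in H1 & H2, forall x y, ~~ e x y} ->
  proper (S :|: H1) f -> proper (S :|: H2) g ->
  colorable e setT #|C|.+1.
Proof.
move=> S5 cover noe pf pg.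
have [A [B [sAS sBS monA monB eqk]]] := common_extraction f g S5.
(* Both colourings are proper on all of [S], so a class of either one is independent there. *)
have ind (D : {set T}) : D \subset S -> monochromatic D f \/ monochromatic D g ->
    {in D &, forall x y, ~~ e x y}.
  move=> /subsetP sDS mono x y Dx Dy; apply/negP => exy.
  have in1 z H : z \in D -> z \in S :|: H by move=> /sDS; rewrite inE => ->.
  have := pf x y (in1 _ _ Dx) (in1 _ _ Dy) exy.
  have := pg x y (in1 _ _ Dx) (in1 _ _ Dy) exy.
  by case: mono => /(_ x y Dx Dy) ->; rewrite eqxx.
set f' := extract (mem A) f in eqk; set g' := extract (mem B) g in eqk.
have pf' : proper (S :|: H1) f' by apply: proper_extract pf (ind _ sAS monA).
have pg' : proper (S :|: H2) g' by apply: proper_extract pg (ind _ sBS monB).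
have [|p eqp] := @perm_matching _ _ (enum S) f' g'.
  by move=> x y; rewrite !mem_enum; apply: eqk.
pose h x := if x \in S :|: H1 then p (f' x) else g' x.
have hg x : x \in S :|: H2 -> x \in S :|: H1 -> x \in S -> h x = g' x.
  by move=> _ x1 xS; rewrite /h x1 eqp ?mem_enum.
apply: (@proper_colorable _ _ h); first by rewrite card_option.
have in2 x : x \notin S :|: H1 -> x \in H2.
  by have := in_setT x; rewrite -cover inE => /orP[->|].
(* An edge leaving [S :|: H1] ends in [H2], so it starts in [S], where [h] agrees with [g']. *)
have side x y : e x y -> x \in S :|: H1 -> y \notin S :|: H1 -> h x != h y.
  move=> exy x1 y1; have y2 := in2 _ y1.
  have xS : x \in S.
    move: x1; rewrite inE => /orP[//|x1].
    by move: (noe x y x1 y2); rewrite exy.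
  rewrite /h x1 (negPf y1) eqp ?mem_enum //; apply: pg' => //.
    by rewrite inE xS.
  by rewrite inE y2 orbT.
move=> x y _ _ exy.
have [x1|x1] := boolP (x \in S :|: H1); have [y1|y1] := boolP (y \in S :|: H1).
- by rewrite /h x1 y1 (inj_eq perm_inj) pf'.
- exact: side.
- by rewrite eq_sym side // esym.
- by rewrite /h (negPf x1) (negPf y1) pg' // inE in2 ?orbT.
Qed.

(** The chromatic number in view is [n.+3]. Each edge lies in [n.+1] triangles, so degrees are at
    least [n.+2]; equality would make a closed neighbourhood a clique on [n.+3] vertices, which
    criticality forces to be the whole graph. *)
Lemma double_critical_degree n :
  ~~ colorable e setT n.+2 ->
  (forall v, colorable e [set~ v] n.+2) ->
  (forall x y, e x y -> colorable e (~: [set x; y]) n.+1) ->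
  ~ complete e -> forall x, n.+2 < #|[set z | e x z]|.
Proof.
move=> ncol crit dcrit ncompl x; set N := [set z | e x z].
have common y : e x y -> n.+1 <= #|[set z | e x z && e y z]|.
  move=> exy; have [f pf] := colorable_proper (dcrit x y exy).
  rewrite -{1}(card_ord n.+1) -cardsT.
  suff <- : f @: [set z | e x z && e y z] = setT by apply: leq_imset_card.
  apply/setP => c; rewrite inE; apply/imsetP.
  have [|z [exz eyz fz]] := common_neighbour c _ exy pf.
    by rewrite card_ord.
  by exists z; rewrite ?inE ?exz.
have sub y : e x y -> [set z | e x z && e y z] \subset N :\ y.
  move=> exy; apply/subsetP => z; rewrite !inE => /andP[-> eyz].
  by rewrite andbT; apply: contraTneq eyz => ->; rewrite eirr.
have cardN y : e x y -> #|N| = #|N :\ y|.+1.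
  by move=> exy; rewrite (cardsD1 y) inE exy.
(* If [x] were isolated, a colouring of the rest would already be proper on the whole graph. *)
have [y exy] : exists y, e x y.
  case: (pickP (e x)) => [y|isol]; first by exists y.
  have [f pf] := colorable_proper (crit x).
  case/negP: ncol; apply: (@proper_colorable _ _ f); first by rewrite card_ord.
  move=> u v _ _ euv; apply: pf => //; rewrite !inE; apply: contraTneq euv => ->.
    by rewrite isol.
  by rewrite esym isol.
have degx : n.+1 < #|N|.
  by rewrite (cardN y exy) ltnS (leq_trans (common y exy)) // subset_leq_card ?sub.
rewrite ltn_neqAle degx andbT; apply/eqP => degE.
(* In the equality case [N :\ u] has only [n.+1] elements, so the common neighbours of [x] and [u]
   fill it. *)
have clique u v : e x u -> e x v -> u != v -> e u v.
  move=> exu exv neq.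
  have /eqP eqN : [set z | e x z && e u z] == N :\ u.
    rewrite eqEcard sub //= -ltnS -cardN // -degE ltnS; exact: common.
  have : v \in N :\ u by rewrite !inE exv eq_sym neq.
  by rewrite -eqN inE => /andP[].
have cliqueK : {in x |: N &, forall u v, u != v -> e u v}.
  move=> u v; rewrite !inE => /orP[/eqP->|exu] /orP[/eqP->|exv].
  - by rewrite eqxx.
  - by [].
  - by rewrite esym.
  - exact: clique.
have cardK : #|x |: N| = n.+3 by rewrite cardsU1 inE eirr -degE.
suff KT w : w \in x |: N by apply: ncompl => u v; apply: cliqueK.
(* A vertex [w] off the clique could be deleted, leaving [n.+3] pairwise adjacent vertices coloured
   with [n.+2] colours. *)
apply: contraT => nKw; have [f pf] := colorable_proper (crit w).
have injf : {in x |: N &, injective f}.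
  move=> u v Ku Kv fuv; apply/eqP; apply: contraTT isT => neq.
  have nw z : z \in x |: N -> z \in [set~ w].
    by move=> Kz; rewrite !inE; apply: contraNneq nKw => <-.
  by have := pf u v (nw u Ku) (nw v Kv) (cliqueK u v Ku Kv neq); rewrite fuv eqxx.
have := max_card (mem (f @: (x |: N))).
by rewrite card_in_imset // cardK card_ord ltnn.
Qed.

End Colourings.

(** * Small separating sets are impossible *)

Theorem theorem21 (T : finType) (e : rel T) (k : nat) :
  symmetric e -> irreflexive e ->
  double_critical e -> chiG e = k -> 6 <= k -> ~ complete e ->
  k_connected e 6.
Proof.
move=> esym eirr [crit dcrit] chik k6 ncompl.
(* Writing [k] as [n.+3] turns [k - 1] and [k - 2] into the successors [n.+2] and [n.+1]. *)
case: k => [|[|[|n]]] // in chik k6.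
have ncol : ~~ colorable e setT n.+2.
  by apply/negP => /chi_leq; rewrite -/(chiG e) chik ltnn.
have vcol v : colorable e [set~ v] n.+2.
  by apply: colorable_leq (colorable_chi eirr _); rewrite -ltnS -chik; apply: crit.
have ecol x y : e x y -> colorable e (~: [set x; y]) n.+1.
  move=> exy; apply: colorable_leq (colorable_chi eirr _).
  by rewrite (leq_trans (dcrit x y exy)) // chik subn2.
have deg x : 6 <= #|[set z | e x z]|.
  by rewrite (leq_trans k6) ?double_critical_degree.
split.
  (* A vertex with its six neighbours gives more than 6 vertices; the empty graph is complete. *)
  have [x _|noT] := pickP (@predT T).
    rewrite -cardsT (cardsD1 x) inE ltnS (leq_trans (deg x)) //.
    apply: subset_leq_card; apply/subsetP => z; rewrite !inE andbT => exz.
    by apply: contraTneq exz => ->; rewrite eirr.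
  by case: ncompl => x; have := noT x.
move=> S S6 x y xS yS; apply: contraT => nconn.
set r := [rel a b | _] in nconn.
(* [H1] is the component of [x] in the graph minus [S], and [H2] is everything else outside [S]. *)
pose H1 := [set z in ~: S | connect r x z].
pose H2 := [set z in ~: S | ~~ connect r x z].
have noe : {in H1 & H2, forall u v, ~~ e u v}.
  move=> u v; rewrite !inE => /andP[uS cu] /andP[vS]; apply: contra => euv.
  by apply: connect_trans cu (connect1 _); rewrite /= euv !inE uS vS.
have cover : S :|: H1 :|: H2 = setT.
  by apply/setP => z; rewrite !inE; case: (z \in S); case: (connect r x z).
have dis : [disjoint H1 & S :|: H2].
  by rewrite -setI_eq0; apply/eqP/setP => z; rewrite !inE; case: (z \in S); case: (connect r x z).
have dis2 : [disjoint H2 & S :|: H1].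
  by rewrite -setI_eq0; apply/eqP/setP => z; rewrite !inE; case: (z \in S); case: (connect r x z).
(* At least 6 neighbours cannot all fit in [S], which has at most 5 vertices. *)
have inner u (H : {set T}) : (forall v, e u v -> v \in S :|: H) -> exists2 v, v \in H & e u v.
  move=> sub; case: (pickP (fun v => (v \in H) && e u v)) => [v /andP[]|none]; first by exists v.
  have: #|[set z | e u z]| <= #|S|.
    apply: subset_leq_card; apply/subsetP => z; rewrite inE => euz.
    by have := sub z euz; have := none z; rewrite inE euz andbT => ->; rewrite orbF.
  by rewrite leqNgt (leq_trans S6 (deg u)).
have side u v (H K : {set T}) : [disjoint H & K] -> u \in H -> v \in H -> e u v ->
    exists f : T -> 'I_n.+1, proper e K f.
  move=> dHK uH vH /ecol /colorable_proper[f pf]; exists f.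
  apply: proper_sub pf; apply/subsetP => z Kz; rewrite !inE.
  by apply/norP; split; apply: contraTneq Kz => ->; rewrite (disjointFr dHK).
have xH : x \in H1 by rewrite !inE connect0 andbT; rewrite inE in xS.
have yH : y \in H2 by rewrite !inE nconn andbT; rewrite inE in yS.
have [v vH exv] : exists2 v, v \in H1 & e x v.
  apply: inner => v exv; apply: contraT => vn.
  have vH : v \in H2 by move: (in_setT v); rewrite -cover inE (negPf vn).
  by move: (noe x v xH vH); rewrite exv.
have [w wH eyw] : exists2 w, w \in H2 & e y w.
  apply: inner => w eyw; apply: contraT => wn.
  have wH : w \in H1.
    by move: (in_setT w) wn; rewrite -cover !inE => /orP[/orP[]->|->]; rewrite ?orbT.
  by move: (noe w y wH yH); rewrite esym eyw.
have [g pg] := side x v _ _ dis xH vH exv.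
have [f pf] := side y w _ _ dis2 yH wH eyw.
case/negP: ncol; have := colorable_glue esym _ cover noe pf pg.
by rewrite card_ord; apply; rewrite -ltnS.
Qed.
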